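(* Let $P(z)=z^5+az^4+bz^3+c$ with $a,b,c\in\mathbb{C}$ be an NCIP with $8a^2\neq 5b$. Then $P(z)$ is not a UPM in $\mathbb{C}$.
   Context: A polynomial $P$ is a CIP (critically injective polynomial) if $P(d)\neq P(d')$ for any two distinct zeros $d,d'$ of $P'$; otherwise it is an NCIP. A non-constant polynomial $P$ is a UPM in $\mathbb{C}$ if for any two non-constant meromorphic functions $f,g$ on $\mathbb{C}$, the identity $P(f)=P(g)$ implies $f=g$. *)

(* Defs.v *)
From HB Require Import structures.
From mathcomp Require Import all_boot all_order all_algebra.
From mathcomp Require Import complex.
From mathcomp Require Import all_classical all_reals all_analysis.

Set Implicit Arguments.
Unset Strict Implicit.
Unset Printing Implicit Defensive.

Import Order.TTheory GRing.Theory Num.Theory.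
Import numFieldNormedType.Exports.

Local Open Scope classical_set_scope.
Local Open Scope ring_scope.
Local Open Scope complex_scope.

(* The complex plane as a normed space over itself: [derivable _ z 1] on
   [C R -> C R] is then complex differentiability at z, the increments
   ranging over R[i]. *)
Definition C (R : realType) : normedModType R[i] := (R[i])^o.

(* Critically injective polynomials. *)
Definition CIP (R : realType) (P : {poly R[i]}) : Prop :=
  forall d d' : R[i],
    root P^`() d -> root P^`() d' -> d != d' -> P.[d] != P.[d'].

Definition NCIP (R : realType) (P : {poly R[i]}) : Prop := ~ CIP P.

(* A meromorphic function is a map to the Riemann sphere, with [None] the
   point at infinity taken exactly at the poles.  The set where f is finite
   is open and f is holomorphic on it; at a pole, |f| tends to infinity (in
   particular f is finite on a punctured neighbourhood, so that poles are
   isolated).  With poles and removable singularities thus normalised,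
   equality of meromorphic functions is pointwise equality.
   The value 0 in [odflt] is irrelevant, f being finite near z0. *)
Definition meromorphic (R : realType) (f : C R -> option (C R)) : Prop :=
  forall z0 : C R,
    if f z0 is Some _ then
      (\forall z \near z0, f z <> None) /\
      derivable (fun z : C R => odflt (0 : C R) (f z)) z0 (1 : R[i])
    else
      forall M : R, \forall z \near z0^',
        exists2 w : C R, f z = Some w & M%:C < `|w|.

Definition nonconstant (R : realType) (f : C R -> option (C R)) : Prop :=
  ~ exists w : option (C R), forall z : C R, f z = w.

(* P(f), for P nonconstant: it has the same poles as f. *)
Definition poly_comp_mero (R : realType) (P : {poly R[i]})
    (f : C R -> option (C R)) : C R -> option (C R) :=
  fun z => omap (fun w : R[i] => P.[w]) (f z).

(* Uniqueness polynomials for meromorphic functions on the complex plane. *)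
Definition UPM (R : realType) (P : {poly R[i]}) : Prop :=
  (1 < size P)%N /\
  forall f g : C R -> option (C R),
    meromorphic f -> meromorphic g -> nonconstant f -> nonconstant g ->
    poly_comp_mero P f =1 poly_comp_mero P g -> f =1 g.

(* Main.v *)
Require Import Defs.
From HB Require Import structures.
From mathcomp Require Import all_boot all_order all_algebra.
From mathcomp Require Import complex.
From mathcomp Require Import all_classical all_reals all_analysis.
From mathcomp Require Import ring.

Import Order.TTheory GRing.Theory Num.Theory.
Import numFieldNormedType.Exports.

Set Implicit Arguments.
Unset Strict Implicit.
Unset Printing Implicit Defensive.

Local Open Scope classical_set_scope.
Local Open Scope ring_scope.
Local Open Scope complex_scope.

(** For two distinct critical points d, d' with P(d) = P(d'), there are only two
    possibilities.  If both are nonzero, they are the roots of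
    5 z^2 + 4 a z + 3 b, and in terms of s = d + d' and p = d d' one finds
      12 (P(d') - P(d)) = (d - d')^3 (3 s^2 - 2 p),
    so that 3 s^2 = 2 p, which is the excluded relation 8 a^2 = 5 b.  Otherwise
    one of them is 0, and then the other one is a double root of
    z^2 + a z + b, i.e. P(z) = z^3 (z + k)^2 + c with a = 2 k, b = k^2 and
    k != 0 ([quintic_equal_critical_values]).

    For such a P, the equation f^3 (f + k)^2 = g^3 (g + k)^2 holds as soon as
    f = s^2 g and g + k = s^3 (f + k) for some s.  Solving these two linear
    equations gives
      g = - k (1 + s + s^2) / (1 + s + s^2 + s^3 + s^4),  f = s^2 g,
    rational functions of s, hence meromorphic functions of s on the plane
    ([rational_map_meromorphic]).  They are nonconstant and distinct, but
    P(f) = P(g) ([quintic_parametrization]), so P is not a UPM. *)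

Definition rational_map (R : realType) (N D : {poly R[i]}) :
    C R -> option (C R) :=
  fun z => if D.[z] == 0 then None else Some (N.[z] / D.[z]).

Lemma horner_derivable (K : numFieldType) (p : {poly K}) (z : K) :
  derivable (horner p : K^o -> K^o) z 1.
Proof.
elim/poly_ind: p => [|p r ih].
  rewrite (_ : horner 0 = cst 0); first exact: derivable_cst.
  by apply/funext => y; rewrite horner0.
rewrite (_ : horner (p * 'X + r%:P) = (horner p : K^o -> K) * id + cst r).
  by apply: derivableD; [apply: derivableM|exact: derivable_cst].
by apply/funext => y; rewrite !hornerE !fctE.
Qed.

Lemma horner_continuous (K : numFieldType) (p : {poly K}) :
  continuous (horner p : K^o -> K^o).
Proof.
move=> z; apply: (@differentiable_continuous K K^o K^o).
exact/derivable1_diffP/horner_derivable.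
Qed.

Lemma near_horner_neq0 (K : numFieldType) (p : {poly K}) (z0 : K^o) :
  p.[z0] != 0 -> \forall z \near z0, p.[z] != 0.
Proof.
by move=> p0; exact: (cvgr_neq0 _ (horner_continuous (p:=p) (x:=z0)) p0).
Qed.

(** The zeros of a nonzero polynomial are isolated: split off the power of
    [X - z0] dividing it and use continuity of the cofactor. *)
Lemma dnear_horner_neq0 (K : numFieldType) (p : {poly K}) (z0 : K^o) :
  p != 0 -> \forall z \near z0^', p.[z] != 0.
Proof.
move=> p0; have [m [q]] := multiplicity_XsubC p z0.
rewrite p0 /= => qz0 pE.
have q0 : \forall z \near z0^', q.[z] != 0.
  by apply: nbhs_dnbhs; exact: near_horner_neq0.
near=> z; rewrite pE hornerM horner_exp hornerXsubC mulf_neq0 //.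
  by near: z.
rewrite expf_neq0 // subr_eq0; near: z; exact: nbhs_dnbhs_neq.
Unshelve. all: by end_near. Qed.

(** Coprimality makes the zeros of the denominator genuine poles: there the
    numerator does not vanish, so the inverse D / N is continuous with value
    0. *)
Lemma rational_map_meromorphic (R : realType) (N D : {poly R[i]}) :
  D != 0 -> coprimep N D -> meromorphic (rational_map N D).
Proof.
move=> D0 ND z0; rewrite /rational_map.
have [Dz0|Dz0] := boolP (D.[z0] == 0); last first.
  have nD : \forall z \near z0, D.[z] != 0 by exact: near_horner_neq0.
  split; first by apply: filterS nD => z /negbTE ->.
  apply: (@near_eq_derivable _ _ _ (fun z : C R => N.[z] / D.[z] : C R)).
    by apply: filterS nD => z /= /negbTE ->.
  apply: (@derivableM _ _ (horner N : C R -> R[i])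
            (fun z : C R => (D.[z])^-1 : R[i])).
    exact: horner_derivable.
  by apply: derivableV => //; exact: horner_derivable.
move=> M.
(* |N / D| > |M| + 1 is obtained as |D / N| < (|M| + 1)^-1; taking |M| + 1
   instead of M makes the bound positive. *)
have Nz0 : N.[z0] != 0 by apply: coprimep_root Dz0; rewrite coprimep_sym.
have cDN : (fun z : C R => D.[z] / N.[z] : C R) @ z0 --> (0 : C R).
  rewrite -(mul0r (N.[z0])^-1) -[X in X / _](eqP Dz0).
  have cp (p : {poly R[i]}) :
    (horner p : (R[i])^o -> (R[i])^o) @ (z0 : (R[i])^o) --> (p.[z0] : (R[i])^o).
    exact: horner_continuous.
  exact: (cvgM (cp D) (cvgV Nz0 (cp N))).
have M0 : 0 < (`|M| + 1)%:C :> R[i] by rewrite ltcR ltr_wpDl.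
have nDN : \forall z \near z0^', `|D.[z] / N.[z]| < ((`|M| + 1)%:C)^-1.
  by apply: nbhs_dnbhs; apply: (cvgr0_norm_lt _ cDN); rewrite invr_gt0.
have nN : \forall z \near z0^', N.[z] != 0.
  by apply: nbhs_dnbhs; exact: near_horner_neq0.
have nD : \forall z \near z0^', D.[z] != 0 by exact: dnear_horner_neq0.
apply: filterS3 nDN nN nD => z lt_DN Nz Dz.
exists (N.[z] / D.[z]); first by rewrite (negbTE Dz).
have {lt_DN}ND_gt : (`|M| + 1)%:C < `|N.[z] / D.[z]|.
  have NDz : 0 < `|N.[z] / D.[z]| by rewrite normr_gt0 mulf_neq0 ?invr_eq0.
  by rewrite -(ltf_pV2 NDz M0) -normfV invf_div.
have M_le : M%:C <= (`|M| + 1)%:C :> R[i].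
  by rewrite lecR (le_trans (ler_norm M)) ?lerDl ?ler01.
exact: (le_lt_trans M_le ND_gt).
Qed.

Lemma quintic_derivative (F : comNzRingType) (a b c z : F) :
  ('X^5 + a *: 'X^4 + b *: 'X^3 + c%:P)^`().[z] =
  z ^+ 2 * (5 * z ^+ 2 + 4 * a * z + 3 * b).
Proof.
by rewrite !poly.derivE !hornerE /=; ring.
Qed.

Lemma quintic_horner (F : comNzRingType) (a b c z : F) :
  ('X^5 + a *: 'X^4 + b *: 'X^3 + c%:P).[z] =
  z ^+ 5 + a * z ^+ 4 + b * z ^+ 3 + c.
Proof. by rewrite !hornerE. Qed.

(** Up to exchanging d and d', d' is nonzero.  If d = 0, then d' is a common
    root of z^2 + a z + b and 5 z^2 + 4 a z + 3 b; the combination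
    (5 z^2 + 4 a z + 3 b) - 3 (z^2 + a z + b) = z (2 z + a) then gives
    a = - 2 d'.  If d is nonzero too, a and b are determined by d and d' through
    Vieta's formulas, and P(d) = P(d') becomes a relation between d + d' and
    d d' which contradicts the hypothesis on a and b. *)
Lemma quintic_equal_critical_values (F : numFieldType) (a b c d d' : F) :
  let P : {poly F} := 'X^5 + a *: 'X^4 + b *: 'X^3 + c%:P in
  root P^`() d -> root P^`() d' -> d != d' -> P.[d] = P.[d'] ->
  8 * a ^+ 2 != 5 * b ->
  exists2 k : F, k != 0 & a = 2 * k /\ b = k ^+ 2.
Proof.
move=> P; rewrite /root !quintic_derivative /P !quintic_horner.
wlog d'0 : d d' / d' != 0.
  move=> H rd rd' dd' PE ab.
  have [d'0|d'0] := eqVneq d' 0; last exact: (H d d').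
  by apply: (H d' d) => //; [rewrite -d'0|rewrite eq_sym].
rewrite !mulf_eq0 !orbb (negbTE d'0) /= => rd /eqP rd' dd' PE ab.
have nat0 n : n.+1%:R != 0 :> F by rewrite pnatr_eq0.
case/orP: rd => [/eqP d0|/eqP rd].
  exists (- d'); first by rewrite oppr_eq0.
  have e : d' ^+ 2 + a * d' + b = 0.
    have : d' ^+ 3 * (d' ^+ 2 + a * d' + b) = 0.
      move: PE; rewrite d0 => PE.
      transitivity ((d'^+5 + a * d'^+4 + b * d'^+3 + c) - c); first by ring.
      by rewrite -PE; ring.
    by move/eqP; rewrite mulf_eq0 expf_eq0 (negbTE d'0) => /eqP.
  have ae : a = 2 * - d'.
    have : d' * (2 * d' + a) = 0.
      transitivity ((5 * d' ^+ 2 + 4 * a * d' + 3 * b)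
                    - 3 * (d' ^+ 2 + a * d' + b)); first by ring.
      by rewrite rd' e; ring.
    move/eqP; rewrite mulf_eq0 (negbTE d'0) /= addr_eq0 => /eqP h.
    by rewrite -[a]opprK -h mulrN.
  split=> //; apply: (addrI (d' ^+ 2 + a * d')).
  by rewrite e ae; ring.
exfalso; move/eqP: ab; apply.
(* Vieta's formulas for the roots d, d' of 5 z^2 + 4 a z + 3 b. *)
have dd0 : d - d' != 0 by rewrite subr_eq0.
have ae : 4 * a = - 5 * (d + d').
  apply: (mulfI dd0); apply/eqP; rewrite -subr_eq0; apply/eqP.
  transitivity ((5 * d ^+ 2 + 4 * a * d + 3 * b)
                - (5 * d' ^+ 2 + 4 * a * d' + 3 * b)); first by ring.
  by rewrite rd rd' subrr.
have {}ae : a = - (5 / 4) * (d + d').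
  by apply: (mulfI (nat0 3%N)); rewrite ae; field.
have be : b = 5 / 3 * (d * d').
  apply: (mulfI (nat0 2%N)); apply/eqP; rewrite -subr_eq0; apply/eqP.
  by rewrite -rd ae; field.
have : (d - d') ^+ 3 * (3 * (d + d') ^+ 2 - 2 * (d * d')) = 0.
  transitivity (12 * ((d' ^+ 5 + a * d' ^+ 4 + b * d' ^+ 3 + c)
     - (d ^+ 5 + a * d ^+ 4 + b * d ^+ 3 + c))); first by rewrite ae be; field.
  by rewrite PE subrr mulr0.
move/eqP; rewrite mulf_eq0 expf_eq0 (negbTE dd0) /= => /eqP e.
apply/eqP; rewrite -subr_eq0; apply/eqP.
transitivity (25 / 6 * (3 * (d + d') ^+ 2 - 2 * (d * d'))).
  by rewrite ae be; field.
by rewrite e mulr0.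
Qed.

(** The quotients of X^3 - 1 and X^5 - 1 by X - 1. Eliminating f from
    f = s^2 g and g + k = s^3 (f + k) gives g (1 - s^5) = k (s^3 - 1); the
    common factor s - 1 is cancelled to make the fraction irreducible. *)
Definition quot3 (F : fieldType) : {poly F} := 1 + 'X + 'X^2.
Definition quot5 (F : fieldType) : {poly F} := 1 + 'X + 'X^2 + 'X^3 + 'X^4.

Lemma horner_quot3 (F : fieldType) (s : F) : (quot3 F).[s] = 1 + s + s ^+ 2.
Proof. by rewrite !hornerE. Qed.

Lemma horner_quot5 (F : fieldType) (s : F) :
  (quot5 F).[s] = 1 + s + s ^+ 2 + s ^+ 3 + s ^+ 4.
Proof. by rewrite !hornerE. Qed.

Lemma quot5_neq0 (F : fieldType) : quot5 F != 0.
Proof.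
apply/eqP => /(congr1 (horner^~ 0)) /eqP.
by rewrite horner_quot5 horner0 !expr0n /= !addr0 oner_eq0.
Qed.

Lemma coprimep_quot3_quot5 (F : fieldType) : coprimep (quot3 F) (quot5 F).
Proof.
apply/Bezout_coprimepP; exists (1 + 'X^3, - 'X) => /=.
by rewrite (_ : _ + _ = 1) ?eqpxx// /quot3 /quot5; ring.
Qed.

Lemma coprimep_Xn_quot5 (F : fieldType) (n : nat) : coprimep 'X^n (quot5 F).
Proof.
apply/coprimep_expl/Bezout_coprimepP.
exists (- (1 + 'X + 'X^2 + 'X^3), 1) => /=.
by rewrite (_ : _ + _ = 1) ?eqpxx// /quot5; ring.
Qed.

(** With f and g the two fractions and D the value of [quot5], one has
    f + k = k (1 + s) / D and g + k = k s^3 (1 + s) / D; hence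
    (g + k)^2 = s^6 (f + k)^2, while f^3 = s^6 g^3. *)
Lemma quintic_parametrization (F : fieldType) (k c s : F) :
  (quot5 F).[s] != 0 ->
  let P := 'X^5 + (2 * k) *: 'X^4 + (k ^+ 2) *: 'X^3 + c%:P in
  P.[(- k *: ('X^2 * quot3 F)).[s] / (quot5 F).[s]] =
  P.[(- k *: quot3 F).[s] / (quot5 F).[s]].
Proof.
rewrite horner_quot5 => D0 /=.
rewrite !quintic_horner !(hornerZ, hornerM, hornerX) horner_quot3.
by field.
Qed.

Theorem theorem3p9 (R : realType) (a b c : R[i]) :
  let P : {poly R[i]} := 'X^5 + a *: 'X^4 + b *: 'X^3 + c%:P in
  NCIP P -> 8 * a ^+ 2 != 5 * b -> ~ UPM P.
Proof.
move=> P ncip ab [_ upm].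
have [k k0 [ae be]] : exists2 k : R[i], k != 0 & a = 2 * k /\ b = k ^+ 2.
  apply: contrapT => nk; apply: ncip => d d' rd rd' dd'.
  apply/eqP => PE; apply: nk.
  exact: quintic_equal_critical_values rd rd' dd' PE ab.
set D := quot5 R[i].
set Nf := - k *: ('X^2 * quot3 R[i]).
set Ng := - k *: quot3 R[i].
have k0' : - k != 0 by rewrite oppr_eq0.
(* The values at 0 and 1 show that the two maps are nonconstant, and those at 0
   that they differ. *)
have D_0 : D.[0] = 1 by rewrite horner_quot5 !expr0n /= !addr0.
have D_1 : D.[1] = 5 by rewrite horner_quot5 !expr1n; ring.
have f0 : rational_map Nf D 0 = Some 0.
  rewrite /rational_map D_0 oner_eq0.
  by rewrite !(hornerZ, hornerM, hornerX) !(mul0r, mulr0).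
have f1 : rational_map Nf D 1 = Some (- k * 3 / 5).
  rewrite /rational_map D_1 pnatr_eq0; congr Some.
  by rewrite !(hornerZ, hornerM, hornerX) horner_quot3 !expr1n; field.
have g0 : rational_map Ng D 0 = Some (- k).
  rewrite /rational_map D_0 oner_eq0; congr Some.
  by rewrite hornerZ horner_quot3 expr0n /= !addr0 divr1 mulr1.
have g1 : rational_map Ng D 1 = Some (- k * 3 / 5).
  rewrite /rational_map D_1 pnatr_eq0; congr Some.
  by rewrite hornerZ horner_quot3 !expr1n; field.
have fg : rational_map Nf D =1 rational_map Ng D.
  apply: upm.
  - apply: rational_map_meromorphic; first exact: quot5_neq0.
    by rewrite coprimepZl// coprimepMl coprimep_Xn_quot5 coprimep_quot3_quot5.
  - apply: rational_map_meromorphic; first exact: quot5_neq0.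
    by rewrite coprimepZl// coprimep_quot3_quot5.
  - move=> [w fw]; have := fw 1; rewrite -(fw 0) f0 f1 => -[/eqP].
    by rewrite !mulf_eq0 (negbTE k0') invr_eq0 !pnatr_eq0.
  - move=> [w gw]; have := gw 1; rewrite -(gw 0) g0 g1 => -[e].
    move/eqP: k0'; apply.
    rewrite (_ : - k = 5 / 2 * (- k - - k * 3 / 5)); last by field.
    by rewrite e subrr mulr0.
  - move=> z; rewrite /poly_comp_mero /rational_map.
    case: ifPn => [//|Dz] /=; congr Some.
    by rewrite /P ae be quintic_parametrization.
have := fg 0; rewrite f0 g0 => -[/eqP].
by rewrite eq_sym (negbTE k0').
Qed.
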